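(* Let $q$ be a prime power, let $n$ be a prime, and let $G\le\Gamma(q^n)$ satisfy $|G/(G\cap N)|=n$, where $N$ is the Singer cycle of $\Gamma(q^n)$. Let $\phi$ denote the automorphism $f\mapsto f^q$ of $\mathrm{GF}(q^n)$. Then $G$ is IBIS if and only if one of the following occurs: (1) $G=(N\cap G)\langle\phi\rangle$, with $N^{q-1}\le G$; (2) $G=(N\cap G)\langle\phi b\rangle$, for some $b\in N$ such that $b\notin N^{q-1}(N\cap G)$.
   Context: $\Gamma(q^n)=\{x\mapsto ax^{\sigma}\mid a\in \mathrm{GF}(q^n)^*,\ \sigma\in \mathrm{Gal}(\mathrm{GF}(q^n)/\mathrm{GF}(q))\}$ is the semilinear group acting on $V=\mathrm{GF}(q^n)$. $N$ is the normal cyclic subgroup of order $q^n-1$ consisting of the maps $x\mapsto ax$, identified with $\mathrm{GF}(q^n)^*$. Maps act on the right, so $\phi b$ is the map $x\mapsto x^q b$. For an integer $k$, $N^k=\{x^k\mid x\in N\}$. For a finite permutation group $G$ on $\Omega$, a sequence $(\omega_1,\dots,\omega_t)$ is an irredundant base if its pointwise stabilizer is trivial and no $\omega_i$ is fixed by the pointwise stabilizer of its predecessors. $G$ is IBIS if all its irredundant bases have the same cardinality. A linear group on $V$ is called IBIS if it induces an IBIS permutation group on $V\setminus\{0\}$.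
   Formalization: The formal theorem adds the hypothesis that G∩N is nontrivial; as printed the equivalence fails whenever G∩N=1, e.g. G=⟨φ⟩ with q=n=2, which is IBIS but satisfies neither (1) nor (2). *)

(* Defs.v *)
From HB Require Import structures.
From mathcomp Require Import all_boot all_fingroup all_algebra all_solvable all_field.

Set Implicit Arguments.
Unset Strict Implicit.
Unset Printing Implicit Defensive.

Import GRing.Theory.
Local Open Scope ring_scope.
Local Open Scope group_scope.

Section IBIS.

Variables (T : finType) (Omega : {set T}) (G : {group {perm T}}).

(* A permutation group on Omega is a subgroup of Sym Omega, i.e. a group of   *)
(* permutations of T fixing T outside Omega. The points preceding             *)
(* tnth (in_tuple s) i in s are those of take i s.                            *)
Definition irredundant_base (s : seq T) : Prop :=
  [/\ {subset s <= Omega},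
      'C_G([set x in s] | 'P) = 1
    & forall i : 'I_(size s),
        tnth (in_tuple s) i \notin 'Fix_'P('C_G([set x in take i s] | 'P))].

Definition ibis : Prop :=
  forall s t : seq T,
    irredundant_base s -> irredundant_base t -> size s = size t.

End IBIS.

Definition linear_ibis (V : finZmodType) (G : {group {perm V}}) : Prop :=
  ibis [set~ 0%R] (restr_perm [set~ 0%R] @* G)%G.

Section Semilinear.

(* finvect_type K is K itself, as a finite type and as a splitting field over *)
(* F; thus V is GF(q^n) over F = GF(q), with q = #|F| and n = \dim {:V}.      *)
Variables (F : finFieldType) (K : fieldExtType F).
Local Notation V := (finvect_type K).

(* Permutations compose from left to right: (s * t) x = t (s x). *)
Definition GammaL : {set {perm V}} :=
  [set s : {perm V} | [exists a : V, exists sigma in 'Gal({:V} / 1),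
     (a != 0%R) && [forall x, s x == (a * sigma x)%R]]].

Definition Singer : {set {perm V}} :=
  [set s : {perm V} | [exists a : V,
     (a != 0%R) && [forall x, s x == (a * x)%R]]].

Definition Singer_pow (k : nat) : {set {perm V}} := [set s ^+ k | s in Singer].

Lemma GammaLP (s : {perm V}) :
  reflect (exists a : V, exists2 sigma, sigma \in 'Gal({:V} / 1) &
             a != 0%R /\ forall x, s x = (a * sigma x)%R)
          (s \in GammaL).
Proof.
rewrite inE; apply: (iffP existsP) => -[a].
  case/existsP=> sigma /and3P[sG a0 /forallP H].
  by exists a, sigma => //; split=> // x; apply/eqP.
case=> sigma sG [a0 H]; exists a; apply/existsP; exists sigma.
by rewrite sG a0; apply/forallP=> x; rewrite H.
Qed.

Lemma SingerP (s : {perm V}) :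
  reflect (exists2 a : V, a != 0%R & forall x, s x = (a * x)%R) (s \in Singer).
Proof.
rewrite inE; apply: (iffP existsP) => -[a].
  by case/andP=> a0 /forallP H; exists a => // x; apply/eqP.
by move=> a0 H; exists a; rewrite a0; apply/forallP=> x; rewrite H.
Qed.

Lemma GammaL_group_set : group_set GammaL.
Proof.
apply/group_setP; split=> [|s t].
  apply/GammaLP; exists 1%R, 1; rewrite ?group1 //; split=> [|x].
    exact: oner_neq0.
  by rewrite perm1 gal_id mul1r.
case/GammaLP=> a [u uG [a0 Hs]] /GammaLP[b [v vG [b0 Ht]]]; apply/GammaLP.
exists (b * v a)%R, (u * v); rewrite ?groupM //; split=> [|x].
  by rewrite mulf_neq0 // fmorph_eq0.
by rewrite permM Hs Ht rmorphM galM ?memvf // mulrA.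
Qed.
Canonical GammaL_group := Group GammaL_group_set.

Lemma Singer_group_set : group_set Singer.
Proof.
apply/group_setP; split=> [|s t].
  by apply/SingerP; exists 1%R => [|x]; rewrite ?oner_neq0 // perm1 mul1r.
case/SingerP=> a a0 Hs /SingerP[b b0 Ht]; apply/SingerP.
by exists (b * a)%R => [|x]; rewrite ?mulf_neq0 // permM Hs Ht mulrA.
Qed.
Canonical Singer_group := Group Singer_group_set.

Lemma Frobenius_inj : injective (fun x : V => (x ^+ #|F|)%R).
Proof.
have [alpha _ alphaE] := finField_galois_generator (sub1v {:V}%AS).
have E z : (z ^+ #|F|)%R = alpha z by rewrite alphaE ?memvf // dimv1 expn1.
by move=> x y /=; rewrite !E; apply: fmorph_inj.
Qed.

Definition Frobenius_perm : {perm V} := perm Frobenius_inj.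

End Semilinear.

(* Main.v *)
Require Import Defs.
From mathcomp Require Import all_boot all_fingroup all_algebra all_solvable all_field.

Local Open Scope group_scope.

(** The quotient of the semilinear group by the Singer cycle N is generated by
the image of the Frobenius map phi, so its order divides the prime n. Since N
is regular on nonzero vectors, the stabiliser in G of such a vector embeds in
this quotient; hence it has order 1 or n ([card_stabiliser_dvd]). A subgroup
not contained in N covers the whole quotient, so it contains some phi b with b
in N ([subgroup_has_Frobenius]), and in the case of G such an element generates
G together with N :&: G ([subgroup_mul_Frobenius_coset]).

If all stabilisers have order 1, every irredundant base has length 1; if all
have order n, every irredundant base has length 2, as a group of prime order
has no intermediate subgroup. If both kinds occur, both lengths occur. So G is
IBIS exactly when its stabilisers are all trivial or all nontrivial
([ibis_prime_stabilisers]). A nontrivial G :&: N enters here: it prevents G from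
fixing a nonzero vector, which could not start an irredundant base.

It remains to read off the stabilisers. As phi b sends v to v ^ q * b, it fixes
v exactly when b is multiplication by v ^ (1 - q), so v has a nontrivial
stabiliser iff phi m ^ (1 - q) lies in G, where m in N is multiplication by v
([stabiliser_nontrivP]). If this holds for all m, then m = 1 gives phi in G, and
then N ^ (q - 1) is contained in G: this is the first case. If phi b is in G,
it holds for no m iff b lies outside N ^ (q - 1) (N :&: G): this is the second
case. *)

(** * Irredundant bases when point stabilisers have order 1 or a prime *)

Section PrimeStabilisers.

Set Implicit Arguments.
Unset Strict Implicit.

Variables (T : finType) (Omega : {set T}) (G : {group {perm T}}).

Lemma irredundant_base_seq1 (u : T) :
    G != 1 :> {set _} -> u \in Omega -> 'C_G[u | 'P] = 1 ->
  irredundant_base Omega G [:: u].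
Proof.
move=> ntG uO Cu; split=> [x| |i].
- by rewrite inE => /eqP->.
- by rewrite set_seq1.
case: i => [[|//] lti]; rewrite /tnth /=.
apply: contra ntG => /afixP fixu; rewrite -Cu eq_sym (sameP eqP setIidPl).
apply/subsetP=> g Gg; apply/astab1P/fixu; rewrite inE Gg.
by apply/astabP=> y; rewrite inE.
Qed.

(** The pointwise stabiliser of both points is a proper subgroup of a group of
prime order, hence trivial. *)
Lemma irredundant_base_seq2 (v w : T) :
    v \in Omega -> w \in Omega -> ~~ (G \subset 'C[v | 'P]) ->
    prime #|'C_G[v | 'P]| -> ~~ ('C_G[v | 'P] \subset 'C[w | 'P]) ->
  irredundant_base Omega G [:: v; w].
Proof.
move=> vO wO nfixv prC nfixw; split=> [x| |i].
- by rewrite !inE => /orP[] /eqP->.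
- have ->: [set x in [:: v; w]] = v |: [set w] by apply/setP=> x; rewrite !inE.
  rewrite astabU setIA; apply/eqP; apply: contraR nfixw.
  exact: prime_meetG.
case: i => [[|[|//]] lti]; rewrite /tnth /=; apply/afixP=> fix_.
- case/negP: nfixv; apply/subsetP=> g Gg; apply/astab1P/fix_; rewrite inE Gg.
  by apply/astabP=> y; rewrite inE.
case/negP: nfixw; apply/subsetP=> g Cg; apply/astab1P/fix_.
by rewrite set_seq1.
Qed.

Lemma size_irredundant_base_semiregular (s : seq T) :
    G != 1 :> {set _} -> {in Omega, forall v, 'C_G[v | 'P] = 1} ->
  irredundant_base Omega G s -> size s = 1%N.
Proof.
move=> ntG triv [sO Cs irr].
case: s sO Cs irr => [|v [|w s]] //= sO Cs irr.
  case/eqP: ntG; rewrite -Cs; apply/esym/setIidPl/subsetP=> g _.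
  by apply/astabP=> y; rewrite inE.
have lt1s : 1 < size [:: v, w & s] by [].
case/negP: (irr (Ordinal lt1s)); rewrite /tnth /= ?take0 set_seq1.
rewrite triv ?sO ?mem_head // ; apply/afixP=> g /set1P->; exact: act1.
Qed.

(** The first two points of an irredundant base already have a trivial common
stabiliser, because it is proper in a group of prime order. *)
Lemma size_irredundant_base_prime (s : seq T) :
    G != 1 :> {set _} -> {in Omega, forall v, prime #|'C_G[v | 'P]|} ->
  irredundant_base Omega G s -> size s = 2.
Proof.
move=> ntG pr [sO Cs irr].
case: s sO Cs irr => [|v [|w [|z s]]] //= sO Cs irr.
- case/eqP: ntG; rewrite -Cs; apply/esym/setIidPl/subsetP=> g _.
  by apply/astabP=> y; rewrite inE.
- by have := pr v (sO v (mem_head _ _)); rewrite -set_seq1 Cs cards1.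
have lt1s : 1 < size [:: v, w, z & s] by [].
have lt2s : 2 < size [:: v, w, z & s] by [].
have:= irr (Ordinal lt1s); rewrite /tnth /= set_seq1 => nfixw.
case/negP: (irr (Ordinal lt2s)); rewrite /tnth /= ?take0.
have ->: [set x in [:: v; w]] = v |: [set w] by apply/setP=> x; rewrite !inE.
rewrite astabU setIA; have [->|ntC] := eqVneq ('C_G[v | 'P] :&: 'C[w | 'P]) 1.
  apply/afixP=> g /set1P->; exact: act1.
case/negP: nfixw; apply/afixP=> g Cg; apply/astab1P.
by have/subsetP := prime_meetG (pr v (sO v (mem_head _ _))) ntC; apply.
Qed.

(** If stabilisers of both kinds occur, a point with trivial stabiliser is a
base of length 1, while a point with stabiliser of prime order extends to an
irredundant base of length 2. *)
Lemma ibis_prime_stabilisers :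
    {in G, forall g, perm_on Omega g} -> G != 1 :> {set _} ->
    {in Omega, forall v, ~~ (G \subset 'C[v | 'P])} ->
    {in Omega, forall v, 'C_G[v | 'P] != 1 -> prime #|'C_G[v | 'P]|} ->
  ibis Omega G <-> {in Omega, forall v, 'C_G[v | 'P] = 1}
                   \/ {in Omega, forall v, 'C_G[v | 'P] != 1}.
Proof.
move=> onG ntG nfix pr; split=> [ibisG | [triv | ntriv] s t Bs Bt].
- have [/forall_inP all1|] := boolP [forall v in Omega, 'C_G[v | 'P] == 1].
    by left=> v vO; apply/eqP/all1.
  case/forall_inPn=> v vO ntCv; right=> u uO; apply/eqP=> Cu.
  have [g /setIP[Gg Cvg] g1] := trivgPn _ ntCv.
  have [w gw] : exists w, g w != w.
    apply/existsP; apply: contraNT g1; rewrite negb_exists => /forallP fixg.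
    by apply/eqP/permP=> x; rewrite perm1; apply/eqP; rewrite -[_ == _]negbK.
  have wO : w \in Omega by apply: contraR gw => /(out_perm (onG g Gg))->.
  have B1 := irredundant_base_seq1 ntG uO Cu.
  have nfixw : ~~ ('C_G[v | 'P] \subset 'C[w | 'P]).
    apply/subsetPn; exists g; first exact/setIP.
    by apply/astab1P=> /= /eqP; apply/negP.
  have B2 := irredundant_base_seq2 vO wO (nfix v vO) (pr v vO ntCv) nfixw.
  by have := ibisG _ _ B1 B2.
- by rewrite !size_irredundant_base_semiregular.
have prC : {in Omega, forall v, prime #|'C_G[v | 'P]|}.
  by move=> v vO; apply: pr (ntriv v vO).
by rewrite !size_irredundant_base_prime.
Qed.

End PrimeStabilisers.

(** This removes the restriction to nonzero vectors from the definition of a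
linear IBIS group. *)
Lemma restr_perm_im_id (T : finType) (S : {set T}) (G : {group {perm T}}) :
  {in G, forall g, perm_on S g} -> (restr_perm S @* G)%G = G.
Proof.
move=> onG; apply/val_inj => /=.
have nG g : g \in G -> g \in 'N(S | 'P).
  move=> Gg; apply/astabsP=> x /=; exact: perm_closed (onG g Gg).
have idG : {in G, restr_perm S =1 id}.
  move=> g Gg; apply/permP=> x; have [xS|xS] := boolP (x \in S).
    by rewrite restr_permE ?nG.
  by rewrite (out_perm (onG g Gg)) // (out_perm (restr_perm_on S g)).
by rewrite morphimEsub ?(eq_in_imset idG) ?imset_id //; apply/subsetP.
Qed.

(** * The semilinear group *)

Section Semilinear.

Set Implicit Arguments.
Unset Strict Implicit.

Variables (F : finFieldType) (K : fieldExtType F).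
Local Notation V := (finvect_type K).
Local Notation N := (Singer K).
Local Notation Gamma := (GammaL K).
Local Notation phi := (Frobenius_perm K).
Local Notation q := #|F|.

Lemma Frobenius_permX i (x : V) : (phi ^+ i) x = (x ^+ (q ^ i))%R.
Proof.
elim: i => [|i IHi]; first by rewrite perm1.
by rewrite expgSr permM IHi permE -GRing.exprM -expnSr.
Qed.

Lemma order_Frobenius_perm_dvd : #[phi] %| \dim {:K}.
Proof.
rewrite order_dvdn; apply/eqP/permP=> x; rewrite Frobenius_permX perm1.
have <- : #|{: V}| = (q ^ \dim {:K})%N.
  by rewrite -(card_vspace (fullv : {vspace V})); apply: eq_card => y; rewrite memvf.
exact: expf_card.
Qed.

Lemma Singer_mul (v : V) : v != 0%R -> exists2 m, m \in N & forall x, m x = (v * x)%R.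
Proof.
move=> v0; have inj_v : injective (fun x : V => (v * x)%R) by apply: GRing.mulfI.
by exists (perm inj_v) => [|x]; [apply/SingerP; exists v => // x|]; rewrite permE.
Qed.

Lemma Singer_abelian : abelian N.
Proof.
apply/centsP=> s /SingerP[a _ sE] t /SingerP[b _ tE]; apply/permP=> x.
by rewrite !permM !sE !tE GRing.mulrCA.
Qed.

Lemma Singer_fix1 (s : {perm V}) (v : V) :
  s \in N -> v != 0%R -> s v = v -> s = 1.
Proof.
case/SingerP=> a _ sE v0; rewrite sE -[X in _ = X]GRing.mul1r.
by move/(GRing.mulIf v0) => a1; apply/permP=> x; rewrite sE a1 GRing.mul1r perm1.
Qed.

Lemma SingerX_app (m : {perm V}) (v : V) i :
  (forall x, m x = v * x)%R -> forall x, (m ^+ i) x = (v ^+ i * x)%R.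
Proof.
move=> mE x; elim: i => [|i IHi]; first by rewrite perm1 GRing.expr0 GRing.mul1r.
by rewrite expgSr permM IHi mE GRing.exprS GRing.mulrA.
Qed.

Lemma Singer_sub_GammaL : N \subset Gamma.
Proof.
apply/subsetP=> s /SingerP[a a0 sE]; apply/GammaLP; exists a, 1 => //.
by split=> // x; rewrite sE gal_id.
Qed.

Lemma Frobenius_perm_GammaL : phi \in Gamma.
Proof.
have [alpha /eqP galE alphaE] := finField_galois_generator (sub1v {:V}%AS).
apply/GammaLP; exists 1%R, alpha; first by rewrite galE cycle_id.
split=> [|x]; first exact: GRing.oner_neq0.
by rewrite permE alphaE ?memvf // dimv1 expn1 GRing.mul1r.
Qed.

Lemma GammaL_fix0 s : s \in Gamma -> s 0%R = 0%R.
Proof.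
by case/GammaLP=> a [u _ [_ sE]]; rewrite sE GRing.rmorph0 GRing.mulr0.
Qed.

Lemma Singer_normal : N <| Gamma.
Proof.
rewrite /normal Singer_sub_GammaL; apply/normsP=> s Gs; apply/eqP.
rewrite eqEcard cardJg leqnn andbT; apply/subsetP=> _ /imsetP[t Nt ->].
case/GammaLP: (Gs) => a [u _ [_ sE]]; case/SingerP: Nt => b b0 tE.
apply/SingerP; exists (u b); first by rewrite GRing.fmorph_eq0.
move=> x; rewrite -{2}[x](permKV s) conjgE !permM tE !sE GRing.rmorphM.
by rewrite GRing.mulrCA.
Qed.

(** Every field automorphism over F is a power of the Frobenius map. *)
Lemma GammaL_Frobenius : Gamma = N * <[phi]>.
Proof.
apply/eqP; rewrite eqEsubset mul_subG ?Singer_sub_GammaL ?cycle_subG //;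
  last exact: Frobenius_perm_GammaL.
rewrite andbT; apply/subsetP=> s /GammaLP[a [u Gu [a0 sE]]].
have [alpha /eqP galE alphaE] := finField_galois_generator (sub1v {:V}%AS).
have [i uE] : exists i, u = alpha ^+ i by apply/cycleP; rewrite -galE.
(* The generator alpha of the Galois group acts on vectors as phi does. *)
have alphaX j x : (alpha ^+ j) x = (phi ^+ j) x.
  elim: j x => [|j IHj] x; first by rewrite gal_id perm1.
  rewrite !expgSr galM ?memvf // permM IHj permE alphaE ?memvf //.
  by rewrite dimv1 expn1.
have [m Nm mE] := Singer_mul a0.
have nNphi : <[phi]> \subset 'N(N).
  by rewrite cycle_subG (subsetP (normal_norm Singer_normal)) ?Frobenius_perm_GammaL.
rewrite -(normC nNphi).
apply/mulsgP; exists (phi ^+ i) m; rewrite ?mem_cycle //.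
by apply/permP=> x; rewrite permM mE sE uE alphaX.
Qed.

Lemma card_GammaL_quotient_dvd : #|Gamma / N| %| \dim {:K}.
Proof.
rewrite GammaL_Frobenius quotientMidl.
exact: dvdn_trans (dvdn_quotient _ _) order_Frobenius_perm_dvd.
Qed.

(** A stabiliser meets the regular subgroup N trivially, so it embeds in the
quotient of the semilinear group by N. *)
Lemma card_stabiliser_dvd (G : {group {perm V}}) (v : V) :
  G \subset Gamma -> v != 0%R -> #|'C_G[v | 'P]| %| \dim {:K}.
Proof.
move=> sG v0; apply: dvdn_trans card_GammaL_quotient_dvd.
have sC : 'C_G[v | 'P] \subset Gamma by rewrite subIset ?sG.
rewrite (card_isog (quotient_isog (subset_trans sC (normal_norm Singer_normal)) _)).
  by rewrite cardSg // quotientS.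
apply/trivgP/subsetP=> s /setIP[Ns /setIP[_ /astab1P fixs]]; apply/set1P.
exact: Singer_fix1 Ns v0 fixs.
Qed.

Section PrimeDegree.

Hypothesis prime_dim : prime (\dim {:K}).

(** The image of H in the quotient by N is a nontrivial subgroup of a group of
prime order, hence contains the class of phi. *)
Lemma subgroup_has_Frobenius (H : {group {perm V}}) :
    H \subset Gamma -> ~~ (H \subset N) ->
  exists2 b, b \in N & phi * b \in H.
Proof.
move=> sH nsHN; have nN := normal_norm Singer_normal.
have nNH := subset_trans sH nN.
have ntH : H / N != 1 by rewrite -subG1 quotient_sub1.
have sHG : H / N \subset Gamma / N by rewrite quotientS.
have: Gamma / N \subset H / N.
  rewrite -(setIidPr sHG) in ntH.
  have prG : prime #|Gamma / N|.
    have := card_GammaL_quotient_dvd; case/primeP: (prime_dim) => _ H2.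
    case/H2/orP=> /eqP E; last by rewrite E.
    case/eqP: ntH; apply/trivgP/(subset_trans (subsetIl _ _)).
    by rewrite subG1 trivg_card1 E.
  exact: prime_meetG prG ntH.
move/subsetP/(_ _ (mem_quotient N Frobenius_perm_GammaL)).
case/morphimP=> h nNh Hh eqh; have nNphi := subsetP nN _ Frobenius_perm_GammaL.
exists (phi^-1 * h); last by rewrite mulKVg.
by rewrite -mem_lcoset -norm_rlcoset //; apply/(rcoset_kercosetP nNh nNphi).
Qed.

Variable G : {group {perm V}}.
Hypotheses (sG : G \subset Gamma) (nsGN : ~~ (G \subset N)).

(** The whole semilinear group is the product of N and the cycle of phi b;
Dedekind's modular law then gives the decomposition of G. *)
Lemma subgroup_mul_Frobenius_coset b :
  b \in N -> phi * b \in G -> G :=: (N :&: G) * <[phi * b]>.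
Proof.
move=> Nb Gphib.
have nNphi : phi \in 'N(N) := subsetP (normal_norm Singer_normal) _ Frobenius_perm_GammaL.
rewrite setIC group_modr ?cycle_subG //; apply/esym/setIidPl.
apply: subset_trans sG _.
have nNb : <[phi * b]> \subset 'N(N).
  by rewrite cycle_subG groupM // (subsetP (normG _)).
have -> : N * <[phi * b]> = N <*> <[phi * b]> by rewrite norm_joinEr.
rewrite GammaL_Frobenius mul_subG ?joing_subl // cycle_subG.
have Jb : b \in N <*> <[phi * b]> by rewrite mem_gen // inE Nb.
by rewrite -(groupMr _ Jb) mem_gen // inE cycle_id orbT.
Qed.

(** The vector m 1 stands for an arbitrary nonzero v, with m the multiplication
by v. The stabiliser of v meets N trivially, so when it is nontrivial it
contains some phi b, and then v ^ q * b = v determines b. *)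
Lemma stabiliser_nontrivP m :
    m \in N ->
  ('C_G[m 1%R | 'P] != 1) = (phi * (m ^+ (q - 1))^-1 \in G).
Proof.
move=> Nm; have [v v0 mE] := SingerP _ Nm.
have m1 : m 1%R = v by rewrite mE GRing.mulr1.
have q0 : 0 < q by apply/card_gt0P; exists 0%R.
have fixE b : b \in N -> ((phi * b) v == v) = (b == (m ^+ (q - 1))^-1).
  move=> Nb; apply/eqP/eqP=> [fixv|->].
    apply/eqP; rewrite eq_sym eq_invg_mul; apply/eqP.
    apply: (Singer_fix1 _ v0); first by rewrite groupM ?groupX.
    rewrite permM (SingerX_app _ mE) -GRing.exprSr subn1 prednK //.
    by move: fixv; rewrite permM permE.
  rewrite permM; apply: (canLR (permK _)).
  by rewrite permE (SingerX_app _ mE) -GRing.exprSr subn1 prednK.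
rewrite m1; apply/idP/idP=> [ntC | Gphi].
  have sC : 'C_G[v | 'P] \subset Gamma by rewrite subIset ?sG.
  have nsC : ~~ ('C_G[v | 'P] \subset N).
    apply: contra ntC => sCN; apply/eqP/trivgP/subsetP=> s Cs; apply/set1P.
    case/setIP: (Cs) => _ /astab1P fixs.
    exact: Singer_fix1 (subsetP sCN _ Cs) v0 fixs.
  have [b Nb /setIP[Gb /astab1P /eqP]] := subgroup_has_Frobenius sC nsC.
  by rewrite [_ == _]fixE // => /eqP<-.
(* This element fixes v; were it trivial, phi would lie in N, and so would G. *)
apply: contra nsGN => /eqP C1.
have NX : (m ^+ (q - 1))^-1 \in N by rewrite groupV groupX.
rewrite (subgroup_mul_Frobenius_coset NX Gphi) mul_subG ?subsetIl //.
suff -> : phi * (m ^+ (q - 1))^-1 = 1 by rewrite cycle1 sub1G.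
apply/set1P; rewrite -[[set 1]]C1 inE Gphi; apply/astab1P/eqP.
by rewrite [_ == _]fixE.
Qed.

(** Writing b = m ^ (q - 1) c with c in N :&: G amounts to phi m ^ (q - 1) being
in G, that is, to m^-1 1 having a nontrivial stabiliser. *)
Lemma all_stabilisers_trivialP :
  {in [set~ 0%R : V], forall v, 'C_G[v | 'P] = 1} <->
  exists b : {perm V}, [/\ b \in N, b \notin Singer_pow K (q - 1) * (N :&: G)
                         & G :=: (N :&: G) * <[phi * b]>].
Proof.
split=> [triv | [b [Nb nb GE]] v].
  have [b Nb Gb] := subgroup_has_Frobenius sG nsGN.
  exists b; split=> //; last exact: subgroup_mul_Frobenius_coset.
  apply/mulsgP=> -[_ c /imsetP[m Nm ->] /setIP[Nc Gc] bE].
  have Nmi : m^-1 \in N by rewrite groupV.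
  have := stabiliser_nontrivP Nmi.
  rewrite expgVn invgK triv ?eqxx; last first.
    have [v v0 mE] := SingerP _ Nmi.
    by rewrite !inE mE GRing.mulr1.
  by move/esym/negP; case; rewrite -(groupMr _ Gc) -mulgA -bE.
rewrite !inE => v0; apply/eqP; apply: contraR nb.
have [m Nm mE] := Singer_mul v0.
have <- : m 1%R = v by rewrite mE GRing.mulr1.
rewrite (stabiliser_nontrivP Nm) => Gphi.
have Gb : phi * b \in G.
  rewrite GE; apply/mulsgP; exists 1 (phi * b); rewrite ?cycle_id ?group1 //.
  by rewrite mul1g.
apply/mulsgP; exists (m^-1 ^+ (q - 1)) (m ^+ (q - 1) * b).
- by apply/imsetP; exists m^-1; rewrite ?groupV.
- rewrite inE groupM ?groupX //=.
  have <- : (phi * (m ^+ (q - 1))^-1)^-1 * (phi * b) = m ^+ (q - 1) * b.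
    by rewrite invMg invgK -mulgA mulKg.
  by rewrite groupM ?groupV.
by rewrite expgVn mulKg.
Qed.

(** The vector 1 yields phi in G; then phi m ^ (1 - q) is in G iff m ^ (q - 1)
is. *)
Lemma all_stabilisers_nontrivialP :
  {in [set~ 0%R : V], forall v, 'C_G[v | 'P] != 1} <->
  G :=: (N :&: G) * <[phi]> /\ Singer_pow K (q - 1) \subset G.
Proof.
split=> [ntriv | [GE sNG] v].
  have Gphi m : m \in N -> phi * (m ^+ (q - 1))^-1 \in G.
    move=> Nm; rewrite -stabiliser_nontrivP // ntriv //.
    by have [v v0 mE] := SingerP _ Nm; rewrite !inE mE GRing.mulr1.
  have G1 : phi \in G.
    by have := Gphi 1 (group1 _); rewrite expg1n invg1 mulg1.
  split; last first.
    by apply/subsetP=> _ /imsetP[m Nm ->]; rewrite -groupV -(groupMl _ G1) Gphi.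
  by have := @subgroup_mul_Frobenius_coset 1; rewrite mulg1; apply.
rewrite !inE => v0; have [m Nm mE] := Singer_mul v0.
have <- : m 1%R = v by rewrite mE GRing.mulr1.
rewrite stabiliser_nontrivP // groupM //.
  by rewrite GE; apply/mulsgP; exists 1 phi; rewrite ?cycle_id ?group1 ?mul1g.
by rewrite groupV (subsetP sNG) //; apply/imsetP; exists m.
Qed.

End PrimeDegree.

End Semilinear.

Theorem corollary1p5 (F : finFieldType) (K : fieldExtType F) (q n : nat)
    (hq : #|F| = q) (hn : \dim {:K} = n) (n_prime : prime n)
    (G : {group {perm (finvect_type K)}})
    (sGGamma : G \subset GammaL K)
    (hG : #|G / (G :&: Singer K)| = n)
    (ntGN : G :&: Singer K != 1) :
  let N := Singer K in
  let phi := Frobenius_perm K in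
  linear_ibis G <->
  (G :=: (N :&: G) * <[phi]> /\ Singer_pow K (q - 1) \subset G)
  \/ (exists b : {perm (finvect_type K)},
        [/\ b \in N,
            b \notin Singer_pow K (q - 1) * (N :&: G)
          & G :=: (N :&: G) * <[phi * b]>]).
Proof.
move=> N phi; subst q n.
have nsGN : ~~ (G \subset N).
  apply/negP=> /setIidPl GN; move: hG n_prime.
  by rewrite -{2}GN -[G :&: _]/(G :&: N) GN trivg_quotient cards1 => <-.
have onG : {in G, forall g, perm_on [set~ 0%R] g}.
  move=> g Gg; apply/subsetP=> x; rewrite !inE; apply: contra => /eqP->.
  by rewrite (GammaL_fix0 (subsetP sGGamma _ Gg)).
rewrite /linear_ibis restr_perm_im_id //.
have ntG : G != 1 :> {set _} by apply: contraNneq ntGN => ->; rewrite setI1g.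
(* A nontrivial element of N fixes no nonzero vector, so neither does G. *)
have nfix : {in [set~ 0%R], forall v, ~~ (G \subset 'C[v | 'P])}.
  move=> v; rewrite !inE => v0; apply: contra ntGN => fixv.
  apply/eqP/trivgP/subsetP=> s /setIP[Gs Ns]; apply/set1P.
  by have /astab1P fixs := subsetP fixv _ Gs; apply: Singer_fix1 Ns v0 fixs.
have prC : {in [set~ 0%R], forall v, 'C_G[v | 'P] != 1 -> prime #|'C_G[v | 'P]|}.
  move=> v; rewrite !inE => v0 ntC; have dvC := card_stabiliser_dvd sGGamma v0.
  case/primeP: (n_prime) => _ /(_ _ dvC) /orP[] /eqP E; last by rewrite E.
  by case/eqP: ntC; apply: card1_trivg.
have [ibis1 ibis2] := ibis_prime_stabilisers onG ntG nfix prC.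
have [triv1 triv2] := all_stabilisers_trivialP n_prime sGGamma nsGN.
have [ntriv1 ntriv2] := all_stabilisers_nontrivialP n_prime sGGamma nsGN.
split=> [/ibis1[/triv1 | /ntriv1] | [/ntriv2 | /triv2]].
- by right.
- by left.
- by move=> ntriv; apply: ibis2; right.
by move=> triv; apply: ibis2; left.
Qed.
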